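(* Let $L>0$, $\mu\in(0,L)$, $\kappa:=\mu/L$, and let $N\ge1$ be an integer. Among all constant stepsizes with $\gamma L\in(0,2)$, the worst-case rate for strongly convex functions $$\frac{f(x_0)-f_*}{1+\gamma L\,\min\Big\{\frac{-1+(1-\gamma\mu)^{-2N}}{\gamma\mu},\ \frac{-1+(1-\gamma L)^{-2N}}{\gamma L}\Big\}}$$ is minimized by the choice $\gamma L=\overline{\gamma L}_N(\kappa)$. Consequently, for every $f:\mathbb{R}^d\to\mathbb{R}$ in $\mathcal{F}_{\mu,L}$, with $f_*:=\inf_xf(x)$, and every $x_0\in\mathbb{R}^d$, the iterates $x_{i+1}=x_i-\gamma\nabla f(x_i)$, $i=0,\dots,N-1$, with $\gamma L=\overline{\gamma L}_N(\kappa)$ satisfy $$\frac{1}{2L}\|\nabla f(x_N)\|^2\le\frac{f(x_0)-f_*}{\big(1-\overline{\gamma L}_N(\kappa)\big)^{-2N}}.$$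
   Context: For $L\in(0,\infty)$ and $\mu\in(-\infty,L)$, $\mathcal{F}_{\mu,L}$ is the class of functions $f:\mathbb{R}^d\to\mathbb{R}$ such that both $\frac{L}{2}\|\cdot\|^2-f$ and $f-\frac{\mu}{2}\|\cdot\|^2$ are convex ($\|\cdot\|$ Euclidean norm; such functions are differentiable). For an integer $k\ge1$ let $E_k(x):=\sum_{j=1}^{2k}x^{-j}$ for $x\in\mathbb{R}\setminus\{0\}$ (which equals $\frac{-1+x^{-2k}}{1-x}$ for $x\ne1$ and $2k$ for $x=1$). For $\kappa\in(0,1)$, $\overline{\gamma L}_N(\kappa)$ denotes the unique root $\ell\in\big(1,\frac{2}{1+\kappa}\big)$ of $T_N(\ell,\kappa):=E_N(1-\kappa\ell)-E_N(1-\ell)=0$. When $1-\gamma L=0$ or $1-\gamma\mu=0$, the corresponding power $0^{-2N}$ is read as $+\infty$. *)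

(* Defs.v *)
From HB Require Import structures.
From mathcomp Require Import all_boot all_order all_algebra.
From mathcomp Require Import all_classical all_reals all_analysis.

Set Implicit Arguments.
Unset Strict Implicit.
Unset Printing Implicit Defensive.

Import Order.TTheory GRing.Theory Num.Theory.
Import numFieldNormedType.Exports.

Local Open Scope classical_set_scope.
Local Open Scope ring_scope.

(* The library norm `|x| on row vectors is the max norm, hence this one. *)
Definition enorm (R : realType) (d : nat) (x : 'rV[R]_d) : R :=
  Num.sqrt (\sum_(i < d) x ord0 i ^+ 2).

Definition grad (R : realType) (d : nat) (f : 'rV[R]_d -> R) (x : 'rV[R]_d) :
    'rV[R]_d :=
  \row_(i < d) 'D_(delta_mx ord0 i) (f : 'rV[R]_d -> R^o) x.

Definition Fclass (R : realType) (d : nat) (mu L : R) (f : 'rV[R]_d -> R) : Prop :=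
  convex_function [set: convex_lmodType 'rV[R]_d]
    (fun x => L / 2 * enorm x ^+ 2 - f x) /\
  convex_function [set: convex_lmodType 'rV[R]_d]
    (fun x => f x - mu / 2 * enorm x ^+ 2).

Definition Esum (R : realType) (k : nat) (x : R) : R :=
  \sum_(1 <= j < (2 * k).+1) x ^- j.

Definition Tfun (R : realType) (N : nat) (l kappa : R) : R :=
  Esum N (1 - kappa * l) - Esum N (1 - l).

(* Definite description: [unique P l] is [P l /\ forall l', P l' -> l = l']. *)
Definition gammaLbar (R : realType) (N : nat) (kappa : R) : R :=
  [get l : R |
    unique (fun l : R => 1 < l < 2 / (1 + kappa) /\ Tfun N l kappa = 0) l].

(* The power x^{-2N}; the inverse of \bar R satisfies 0^-1 = +oo. *)
Definition inv_pow2 (R : realType) (N : nat) (x : R) : \bar R :=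
  (((x ^+ (2 * N))%:E)^-1)%E.

(* [delta] stands for f(x_0) - f_*.  The values are in \bar R because one of
   the two terms of the minimum is +oo when 1 - gamma L = 0 or
   1 - gamma mu = 0. *)
Definition sc_rate (R : realType) (mu L : R) (N : nat) (delta gamma : R) : \bar R :=
  (delta%:E /
   (1 + (gamma * L)%:E *
        Order.min ((- 1 + inv_pow2 N (1 - gamma * mu)) / (gamma * mu)%:E)
                  ((- 1 + inv_pow2 N (1 - gamma * L)) / (gamma * L)%:E)))%E.

(* Main.v *)
Require Import Defs.
From HB Require Import structures.
From mathcomp Require Import all_boot all_order all_algebra.
From mathcomp Require Import all_classical all_reals all_analysis.
From mathcomp Require Import ring lra.
Import Order.TTheory GRing.Theory Num.Theory.
Import numFieldNormedType.Exports.
Local Open Scope classical_set_scope.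
Local Open Scope ring_scope.

(** The bound behind the rate is
    [f (x 0) - f (x N) >= gamma / 2 * E_N (1 - gamma L) * |grad f (x N)|^2],
    where [E_N] is the sum of the first [2 N] inverse powers ([gd_decrease]).
    Added to [f (x N) - inf f >= |grad f (x N)|^2 / (2 L)], it gives the factor
    [1 + gamma L * E_N (1 - gamma L) = (1 - gamma L)^(-2N)].

    Write [eta = 1 - gamma mu] and [rho = 1 - gamma L], so that
    [rho < 0 < - rho < eta < 1].  As long as the curvature along the iterates is
    constantly [mu] or constantly [L], the gradients form a geometric sequence of
    ratio [eta] or [rho], and the decrease of [f] is governed by [E_N eta] or
    [E_N rho].  The chosen stepsize is the one where the two agree,
    [E_N eta = E_N rho], so both behaviours are worst cases at once and every
    inequality used in the proof has to be an equality on both.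

    The inequalities at hand are the interpolation inequalities of the class,
    one for each ordered pair of points ([interpolation]); they are equalities
    for quadratics of curvature [mu] and [L].  The decrease bound is a
    nonnegative combination of those for the pairs of iterates at distance one
    and two ([chain_bound]).  Pairs at distance two are brought in because a
    nonnegative quadratic form that couples only consecutive gradients and
    vanishes on both geometric sequences is zero, and this leaves too few
    multipliers when [N > 1].  With the right multipliers the combination is
    an exact identity, without any leftover square:
    - the pair [(k, k+2)] and its reverse are taken in the proportion
      [eta : - rho], which cancels the product of the gradients at [k] and
      [k+2], with a total weight proportional to the gap
      [t_{k+1} = E_{k+1} eta - E_{k+1} rho];
    - cancelling the remaining products of gradients forces the weights on
      consecutive pairs ([multiplier]), and cancelling the squares is a linear
      recursion of order two satisfied by the gap ([Egap_rec]), whose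
      characteristic roots are [eta^-2] and [rho^-2];
    - the condition [t_N = 0] is what makes the chain stop at [N].
    The sign of the multipliers is settled by comparing the growth of
    [eta^(-2k)] and [rho^(-2k)] ([multiplier_ge0], [Egap_ge0]).

    As for optimality, multiply both terms of the minimum in the rate by
    [gamma L].  The first one increases with the stepsize until it meets the
    second one, which decreases from there on; the crossing is
    [E_N eta = E_N rho] ([sc_rate_min]). *)

Set Implicit Arguments.
Unset Strict Implicit.
Unset Printing Implicit Defensive.

(** * Inverse power sums and their gap *)

Section Rates.
Context {R : realType}.
Implicit Types (x eta rho : R) (k N : nat).

Lemma Esum0 x : Esum 0 x = 0.
Proof. by rewrite /Esum muln0 big_nil. Qed.

Lemma EsumS k x : Esum k.+1 x = Esum k x + x ^- (2 * k).+1 + x ^- (2 * k).+2.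
Proof.
by rewrite /Esum mulnS add2n big_nat_recr//= big_nat_recr.
Qed.

Lemma Esum_shift k x : x != 0 -> x ^+ 2 * Esum k.+1 x = Esum k x + 1 + x.
Proof.
move=> x0; elim: k => [|k IH].
  by rewrite EsumS !Esum0 muln0; field.
rewrite EsumS !mulrDr IH [in RHS]EsumS mulnS !exprS.
have := expf_neq0 (2 * k) x0; move: (x ^+ (2 * k)) => y y0.
by field; apply/andP.
Qed.

Lemma Esum_geom k x : x != 0 -> (1 - x) * Esum k x = x ^- (2 * k) - 1.
Proof.
move=> x0; elim: k => [|k IH]; first by rewrite Esum0 muln0; field.
rewrite EsumS !mulrDr IH mulnS !exprS.
have := expf_neq0 (2 * k) x0; move: (x ^+ (2 * k)) => y y0.
by field; apply/andP.
Qed.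

(** The difference that vanishes at the chosen stepsize; up to a positive factor
    it is also the weight of the inequalities two steps apart. *)
Definition Egap eta rho k : R := Esum k eta - Esum k rho.

(** This is the condition that the squared norms of the gradients at the inner
    iterates cancel in the weighted sum of the interpolation inequalities. *)
Lemma Egap_rec eta rho k : eta != 0 -> rho != 0 ->
  Egap eta rho k = (eta ^+ 2 + rho ^+ 2) * Egap eta rho k.+1
    - (eta * rho) ^+ 2 * Egap eta rho k.+2
    - (eta - rho) * (1 + eta) * (1 + rho).
Proof.
move=> e0 r0; rewrite /Egap.
have a1 := Esum_shift k e0; have a2 := Esum_shift k.+1 e0.
have b1 := Esum_shift k r0; have b2 := Esum_shift k.+1 r0.
have <- : eta ^+ 2 * Esum k.+1 eta - 1 - eta = Esum k eta by rewrite a1; ring.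
have <- : rho ^+ 2 * Esum k.+1 rho - 1 - rho = Esum k rho by rewrite b1; ring.
rewrite [X in _ = _ - X - _](_ : _ = rho ^+ 2 * (eta ^+ 2 * Esum k.+2 eta) -
   eta ^+ 2 * (rho ^+ 2 * Esum k.+2 rho)); last by ring.
by rewrite a2 b2; ring.
Qed.

(** The same cancellation at the first iterate. *)
Lemma Egap1 eta rho : eta != 0 -> rho != 0 ->
  (eta * rho) ^+ 2 * Egap eta rho 1 = - ((eta - rho) * (eta + rho + eta * rho)).
Proof.
move=> e0 r0; rewrite /Egap !EsumS !Esum0 muln0.
by field; apply/andP.
Qed.

(** * Signs of the multipliers *)

(** Up to a positive constant, the weight of the inequality
    between the consecutive iterates [k] and [k.+1]: [multiplier rho eta k] when
    it bounds the decrease from below, [multiplier eta rho k] when it bounds it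
    from above.  Exchanging the two ratios exchanges the two directions. *)
Definition multiplier a b k : R :=
  - 2 * b * (a - b) + b * (a + b) * (Egap a b k + Egap a b k.+1)
  + (a - b) * (a * b * Egap a b k.+1 + Egap a b k).

Lemma multiplier0 (a b : R) : a != 0 -> b != 0 ->
  (a * b) ^+ 2 * multiplier a b 0 =
   - b * (a - b) * ((a + b) * (a + b + a ^+ 2 * (1 + b))).
Proof.
move=> a0 b0; rewrite /multiplier /Egap !EsumS !Esum0 muln0.
by field; apply/andP.
Qed.

Lemma multiplier_incr (a b : R) k : a != 0 -> b != 0 ->
  multiplier a b k.+1 - multiplier a b k = (a + b) * (
    a ^- (2 * k) * (a ^- 4 * ((1 + a) * (a ^+ 2 * (1 + b) - a * b + b)))
    - b ^- (2 * k) * (b ^- 3 * ((1 + b) * (b ^+ 2 - b + 1 + a)))).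
Proof.
move=> a0 b0; rewrite /multiplier /Egap !EsumS mulnS !exprS.
have := expf_neq0 (2 * k) a0; move: (a ^+ (2 * k)) => y y0.
have := expf_neq0 (2 * k) b0; move: (b ^+ (2 * k)) => z z0.
by field; rewrite ?a0 ?b0 ?y0 ?z0.
Qed.

Lemma inv_pow_le (eta rho : R) k : rho < 0 -> - rho < eta ->
  0 < eta ^- (2 * k) <= rho ^- (2 * k).
Proof.
move=> r0 re; have e0 : 0 < eta by lra.
have rk : 0 < rho ^+ (2 * k).
  by rewrite exprM exprn_gt0// exprn_even_gt0//= lt_eqF.
have ek : 0 < eta ^+ (2 * k) by rewrite exprn_gt0.
rewrite invr_gt0 ek /= lef_pV2 ?posrE// !exprM.
by rewrite -(sqrrN rho) !lerXn2r ?nnegrE ?sqr_ge0//; lra.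
Qed.

(** The first multiplier is positive by its closed form.  Each increment is a
    combination of [eta ^- (2 * k)] and of the larger [rho ^- (2 * k)], whose
    coefficient is positive and dominates the other one; so it suffices to
    compare the two coefficients. *)
Lemma multiplier_ge0 (eta rho : R) k : rho < 0 -> - rho < eta -> eta < 1 ->
  0 <= multiplier eta rho k /\ 0 <= multiplier rho eta k.
Proof.
move=> r0 re e1.
have e0 : 0 < eta by lra.
have en0 : eta != 0 by rewrite gt_eqF.
have rn0 : rho != 0 by rewrite lt_eqF.
have p0 : 0 < (eta * rho) ^+ 2 by rewrite exprn_even_gt0//= mulf_neq0.
pose r := - rho; have rE : rho = - r by rewrite opprK.
have r0' : 0 < r by lra.
have rle : r <= eta by lra.
have s0 : 0 < eta - r by lra.
elim: k => [|k [IH1 IH2]].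
  split.
    rewrite -(pmulr_rge0 _ p0) multiplier0//; apply: mulr_ge0; first nra.
    by apply: mulr_ge0; nra.
  rewrite -(pmulr_rge0 _ p0) (mulrC eta) multiplier0//.
  have -> : - eta * (rho - eta) * ((rho + eta) * (rho + eta + rho ^+ 2 * (1 + eta)))
    = eta * (eta - rho) * ((eta + rho) * (eta + rho + rho ^+ 2 * (1 + eta))) by ring.
  by apply: mulr_ge0; [nra|apply: mulr_ge0; nra].
have /andP[A0 AB] := inv_pow_le k r0 re.
pose a := eta^-1; pose b := r^-1.
have a0 : 0 < a by rewrite invr_gt0.
have ab : a <= b by rewrite lef_pV2.
have ea : a * eta = 1 by rewrite mulVf.
have rb : b * r = 1 by rewrite mulVf// gt_eqF.
have r3 : rho ^- 3 = - b ^+ 3 by rewrite rE exprVn; field; rewrite gt_eqF.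
have r4 : rho ^- 4 = b ^+ 4 by rewrite rE exprVn; field; rewrite gt_eqF.
have e3 : eta ^- 3 = a ^+ 3 by rewrite exprVn.
have e4 : eta ^- 4 = a ^+ 4 by rewrite exprVn.
have ab3 : eta ^- (2 * k) * a ^+ 3 <= rho ^- (2 * k) * b ^+ 3.
  have a3b3 : a ^+ 3 <= b ^+ 3 by apply: lerXn2r; rewrite ?nnegrE//; lra.
  by apply: ler_pM => //; [exact: ltW|rewrite exprn_ge0// ltW].
have c0 : 0 < eta ^- (2 * k) * a ^+ 3 by rewrite mulr_gt0// exprn_gt0.
split.
- apply: (le_trans IH1); rewrite -subr_ge0 multiplier_incr// r3 e4.
  move: ab3 c0 A0 AB; set A := eta ^- _; set B := rho ^- _ => ab3 c0 A0 AB.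
  apply: mulr_ge0; first lra.
  (* K may be negative; it is bounded below thanks to - rho <= eta. *)
  set K := eta ^+ 2 * _ - _ + _.
  have K_ge : - (eta * (1 + rho) * (1 - eta)) <= K by rewrite /K; nra.
  have lo : - (A * a ^+ 3 * (1 + rho)) <= A * (a ^+ 4 * ((1 + eta) * K)).
    have -> : A * (a ^+ 4 * ((1 + eta) * K)) = A * a ^+ 3 * (a * ((1 + eta) * K)).
      by ring.
    rewrite -mulrN ler_pM2l//.
    have : a * ((1 + eta) * - (eta * (1 + rho) * (1 - eta))) <= a * ((1 + eta) * K).
      by rewrite ler_pM2l// ler_pM2l//; lra.
    apply: le_trans.
    have -> : a * ((1 + eta) * - (eta * (1 + rho) * (1 - eta))) =
      - (a * eta) * ((1 + rho) * (1 - eta ^+ 2)) by ring.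
    by rewrite ea; nra.
  have : A * a ^+ 3 * (1 + rho) <= B * b ^+ 3 * ((1 + rho) * (rho ^+ 2 - rho + 1 + eta)).
    by apply: ler_pM => //; [exact: ltW|lra|nra].
  by lra.
- apply: (le_trans IH2); rewrite -subr_ge0 multiplier_incr// r4 e3.
  move: ab3 c0 A0 AB; set A := eta ^- _; set B := rho ^- _ => ab3 c0 A0 AB.
  apply: mulr_ge0; first lra.
  have : A * a ^+ 3 * ((1 + eta) * (eta ^+ 2 - eta + 1 + rho)) <=
      B * b ^+ 3 * (b * ((1 + rho) * (rho ^+ 2 * (1 + eta) - rho * eta + eta))).
    apply: ler_pM => //; [exact: ltW|apply: mulr_ge0; nra|].
    apply: (@le_trans _ _ (b * r * ((1 + eta) * (1 + rho)))).
      by rewrite rb mul1r ler_pM2l; nra.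
    rewrite -mulrA ler_pM2l ?invr_gt0//.
    rewrite (_ : r * _ = (1 + rho) * (r * (1 + eta))) ?ler_pM2l;
      [by rewrite rE; nra|by lra|by ring].
  by lra.
Qed.

(** The increments of the gap have the form [alpha x ^ k - beta y ^ k] with
    [0 < x < y], hence once negative they remain so: the gap first increases and
    then decreases.  As it vanishes at [0] and at [N], it is nonnegative in
    between. *)
Lemma Egap_ge0 (eta rho : R) k N : rho < 0 -> - rho < eta -> eta < 1 ->
  Egap eta rho N = 0 -> (k <= N)%N -> 0 <= Egap eta rho k.
Proof.
move=> r0 re e1 EN kN.
have e0 : 0 < eta by lra.
pose d j := Egap eta rho j.+1 - Egap eta rho j.
have dE j : d j = (1 + eta) * (eta ^- 2) ^+ j.+1 - (1 + rho) * (rho ^- 2) ^+ j.+1.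
  rewrite /d /Egap !EsumS !exprVn -!exprM mulnS !exprS.
  have := expf_neq0 (2 * j) (lt0r_neq0 e0); move: (eta ^+ (2 * j)) => y y0.
  have rn0 : rho != 0 by rewrite lt_eqF.
  have := expf_neq0 (2 * j) rn0; move: (rho ^+ (2 * j)) => z z0.
  by field; rewrite ?y0 ?z0 ?rn0 gt_eqF.
have dneg j : d j < 0 -> d j.+1 < 0.
  rewrite !dE => h; rewrite 2!(exprS _ j.+1).
  have /andP[x0 xy] := inv_pow_le 1 r0 re; rewrite muln1 in x0 xy.
  move: h; set x := eta ^- 2; set y := rho ^- 2 => h.
  have yj : 0 < y ^+ j.+1 by rewrite exprn_gt0// (lt_le_trans x0).
  move: h; set xx := x ^+ _; set yy := y ^+ _ => h.
  suff : x * ((1 + eta) * xx - (1 + rho) * yy) < 0 /\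
         0 <= (1 + rho) * (yy * (y - x)) by move=> [? ?]; lra.
  split; first by rewrite pmulr_rlt0.
  by rewrite mulr_ge0// ?mulr_ge0//; [lra|exact: ltW|rewrite subr_ge0].
have [//|tk] := leP 0 (Egap eta rho k); exfalso.
have neg j : Egap eta rho j < 0 -> d j < 0.
  elim: j => [|j IH]; first by rewrite /Egap !Esum0; lra.
  move=> tS; have [/IH/dneg//|tj] := ltP (Egap eta rho j) 0.
  by apply: dneg; rewrite /d; lra.
have all j : Egap eta rho (k + j) < 0.
  elim: j => [|j IH]; first by rewrite addn0.
  by rewrite addnS; have := neg _ IH; rewrite /d; lra.
by have := all (N - k)%N; rewrite subnKC// EN ltxx.
Qed.
End Rates.

(** * Combining the inequalities along the chain *)

Section Chain.
Context {R : realType}.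
Implicit Types (eta rho : R) (phi n c : nat -> R).

Lemma EgapC eta rho k : Egap rho eta k = - Egap eta rho k.
Proof. by rewrite /Egap opprB. Qed.

(** Here [phi k] stands for [2 / gamma * f (x k)], [n k] for the squared norm of
    the gradient at [x k], and [c k] for the inner product of the gradients at
    [x k] and [x k.+1]. *)
Lemma chain_bound eta rho N phi n c :
  rho < 0 -> - rho < eta -> eta < 1 -> (0 < N)%N -> Egap eta rho N = 0 ->
  (forall k, (k < N)%N ->
    n k.+1 - 2 * rho * c k + rho ^+ 2 * n k + (eta - rho) * (1 + rho) * n k
      <= (eta - rho) * (phi k - phi k.+1)) ->
  (forall k, (k < N)%N ->
    n k.+1 - 2 * eta * c k + eta ^+ 2 * n k - (eta - rho) * (1 + eta) * n k
      <= (eta - rho) * (phi k.+1 - phi k)) ->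
  (forall k, (k.+1 < N)%N ->
    (eta + rho + eta * rho) * n k + (1 - eta - rho + eta * rho) * n k.+1
      + n k.+2 + 2 * (eta * rho) * c k + 2 * c k.+1
      <= (eta + rho) * (phi k - phi k.+2)) ->
  Esum N rho * n N <= phi 0%N - phi N.
Proof.
move=> r0 re e1 N0 EN fwd bwd two.
have e0 : 0 < eta by lra.
have en0 : eta != 0 by rewrite gt_eqF.
have rn0 : rho != 0 by rewrite lt_eqF.
have s0 : 0 < eta + rho by lra.
have d0 : 0 < eta - rho by lra.
pose t k := Egap eta rho k.
(* The weighted sum of the inequalities among the iterates 0, ..., k.+1.  The
   terms in n k, c k and phi k are those that the pair (k, k.+2) will cancel. *)
have inv k : (k < N)%N ->
  (2 * (eta - rho) + 2 * (eta * rho) * t k.+1 + 2 * t k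
    - (eta + rho) * t k.+1) * n k.+1
  - (eta + rho) * (eta + rho + eta * rho) * t k.+1 * n k
  - 2 * (eta * rho) * (eta + rho) * t k.+1 * c k
  <= 2 * (eta - rho) * (eta + rho) * (phi 0%N - phi k.+1)
     - (eta + rho) ^+ 2 * t k.+1 * (phi k - phi k.+1).
  elim: k => [|k IH] kN.
    have t0 : t 0%N = 0 by rewrite /t /Egap !Esum0 subrr.
    have t1 := Egap1 en0 rn0; rewrite -/(t 1%N) in t1.
    have [w1 w2] := multiplier_ge0 0 r0 re e1.
    rewrite -subr_ge0 -(pmulr_rge0 _ d0).
    have /(mulr_ge0 w2) f1 : 0 <= (eta - rho) * (phi 0%N - phi 1%N) -
      (n 1%N - 2 * rho * c 0%N + rho ^+ 2 * n 0%N + (eta - rho) * (1 + rho) * n 0%N).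
      by rewrite subr_ge0 fwd.
    have /(mulr_ge0 w1) f2 : 0 <= (eta - rho) * (phi 1%N - phi 0%N) -
      (n 1%N - 2 * eta * c 0%N + eta ^+ 2 * n 0%N - (eta - rho) * (1 + eta) * n 0%N).
      by rewrite subr_ge0 bwd.
    have := addr_ge0 f1 f2; rewrite /multiplier ![Egap rho _ _]EgapC -![Egap _ _ _]/(t _).
    rewrite t0; congr (0 <= _).
    have {}t1 : eta ^+ 2 * rho ^+ 2 * t 1%N = - ((eta - rho) * (eta + rho + eta * rho)).
      by rewrite -t1; ring.
    ring: t1.
  have {}IH := IH (ltnW kN).
  have [w1 w2] := multiplier_ge0 k.+1 r0 re e1.
  have tk : 0 <= t k.+1 by apply: Egap_ge0 EN _ => //; exact: ltnW.
  have tE := Egap_rec k en0 rn0; rewrite -![Egap _ _ _]/(t _) in tE.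
  have /(mulr_ge0 w2) f1 : 0 <= (eta - rho) * (phi k.+1 - phi k.+2) -
      (n k.+2 - 2 * rho * c k.+1 + rho ^+ 2 * n k.+1 + (eta - rho) * (1 + rho) * n k.+1).
    by rewrite subr_ge0 fwd.
  have /(mulr_ge0 w1) f2 : 0 <= (eta - rho) * (phi k.+2 - phi k.+1) -
      (n k.+2 - 2 * eta * c k.+1 + eta ^+ 2 * n k.+1 - (eta - rho) * (1 + eta) * n k.+1).
    by rewrite subr_ge0 bwd.
  have f3 := two k kN; rewrite -subr_ge0 in f3.
  have {}f3 := mulr_ge0 (mulr_ge0 (mulr_ge0 (ltW d0) (ltW s0)) tk) f3.
  rewrite -subr_ge0 in IH; have {}IH := mulr_ge0 (ltW d0) IH.
  rewrite -subr_ge0 -(pmulr_rge0 _ d0).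
  have := addr_ge0 (addr_ge0 f1 f2) (addr_ge0 f3 IH).
  rewrite /multiplier ![Egap rho _ _]EgapC -![Egap _ _ _]/(t _).
  congr (0 <= _).
  rewrite tE; ring.
have := inv N.-1; rewrite prednK// leqnn => /(_ isT).
rewrite [t N]EN !(mulr0, mul0r, subr0, addr0).
have -> : 2 * (eta - rho) + 2 * t N.-1 = 2 * (eta - rho) * (eta + rho) * Esum N rho.
  have := Esum_shift N.-1 en0; have := Esum_shift N.-1 rn0.
  rewrite prednK// /t /Egap => h1 h2.
  have -> : Esum N.-1 eta = eta ^+ 2 * Esum N eta - 1 - eta by rewrite h2; ring.
  have -> : Esum N.-1 rho = rho ^+ 2 * Esum N rho - 1 - rho by rewrite h1; ring.
  by move/eqP: EN; rewrite subr_eq0 => /eqP ->; ring.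
by rewrite -!mulrA !ler_pM2l.
Qed.
End Chain.

(** * Euclidean inner product *)

Section Dot.
Context {R : realType} {d : nat}.
Implicit Types (u v w : 'rV[R]_d) (a : R).

Definition dot u v : R := \sum_(i < d) u ord0 i * v ord0 i.

Lemma enorm_sqr u : enorm u ^+ 2 = dot u u.
Proof.
rewrite /enorm sqr_sqrtr; last by apply: sumr_ge0 => i _; exact: sqr_ge0.
by apply: eq_bigr => i _; rewrite expr2.
Qed.

Lemma dotvv_ge0 u : 0 <= dot u u.
Proof. by rewrite -enorm_sqr sqr_ge0. Qed.

Lemma dotC u v : dot u v = dot v u.
Proof. by apply: eq_bigr => i _; rewrite mulrC. Qed.

Lemma dotDl u v w : dot (u + v) w = dot u w + dot v w.
Proof. by rewrite -big_split; apply: eq_bigr => i _; rewrite !mxE mulrDl. Qed.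

Lemma dotZl a u v : dot (a *: u) v = a * dot u v.
Proof. by rewrite /dot mulr_sumr; apply: eq_bigr => i _; rewrite !mxE mulrA. Qed.

Lemma dotNl u v : dot (- u) v = - dot u v.
Proof. by rewrite -scaleN1r dotZl mulN1r. Qed.

Lemma dotDr u v w : dot u (v + w) = dot u v + dot u w.
Proof. by rewrite dotC dotDl !(dotC _ u). Qed.

Lemma dotZr a u v : dot u (a *: v) = a * dot u v.
Proof. by rewrite dotC dotZl dotC. Qed.

Lemma dotNr u v : dot u (- v) = - dot u v.
Proof. by rewrite dotC dotNl dotC. Qed.

Definition dotE := (dotDl, dotDr, dotNl, dotNr, dotZl, dotZr).

End Dot.

(** * Directional derivatives *)

Section Smooth.
Context {R : realType} {d : nat}.
Variables (mu L : R) (f : 'rV[R]_d -> R).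
Hypotheses (mu0 : 0 <= mu) (muL : mu <= L) (fF : Fclass mu L f).
Implicit Types (x v w : 'rV[R]_d) (s t : R).

Lemma Fclass_conv (x y : 'rV[R]_d) t : 0 <= t <= 1 ->
  f (t *: x + (1 - t) *: y) <= t * f x + (1 - t) * f y
     - mu / 2 * (t * (1 - t) * dot (x - y) (x - y)) /\
  t * f x + (1 - t) * f y - L / 2 * (t * (1 - t) * dot (x - y) (x - y)) <=
  f (t *: x + (1 - t) *: y).
Proof.
move=> t01; have [fL fmu] := fF; have [t0 t1] := andP t01.
have tE : forall x y, dot (t *: x + (1 - t) *: y) (t *: x + (1 - t) *: y) =
    t * dot x x + (1 - t) * dot y y - t * (1 - t) * dot (x - y) (x - y).
  by move=> u w; rewrite !dotE (dotC w u); ring.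
have := fmu (Itv01 t0 t1) x y; have := fL (Itv01 t0 t1) x y.
rewrite !inE => /(_ Logic.I Logic.I) hL /(_ Logic.I Logic.I) hmu.
move: hL hmu; rewrite !convRE /conv/= /unstable.onem !enorm_sqr tE.
move: (f _) (f x) (f y) (dot x x) (dot y y) (dot _ _) => fz fx fy a b c.
by split; lra.
Qed.

Lemma divided_difference_bounds x v (a b c : R) : a < b -> b < c ->
  mu / 2 * dot v v * ((b - a) * (c - b) * (c - a)) <=
  (c - b) * f (x + a *: v) + (b - a) * f (x + c *: v) - (c - a) * f (x + b *: v) <=
  L / 2 * dot v v * ((b - a) * (c - b) * (c - a)).
Proof.
move=> ab bc; have ac : 0 < c - a by lra.
pose t := (c - b) / (c - a).
have t01 : 0 <= t <= 1 by rewrite divr_ge0 ?ler_pdivrMr ?mul1r /=; lra.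
have [] := Fclass_conv (x + a *: v) (x + c *: v) t01.
have -> : t *: (x + a *: v) + (1 - t) *: (x + c *: v) = x + b *: v.
  rewrite !scalerDr !scalerA addrACA -!scalerDl subrKC scale1r.
  by congr (_ + _ *: _); rewrite /t; field; rewrite gt_eqF.
have -> : x + a *: v - (x + c *: v) = (a - c) *: v.
  by rewrite opprD addrACA subrr add0r -scalerBl.
rewrite !dotE.
rewrite (_ : 1 - t = (b - a) / (c - a)); last first.
  by rewrite /t; field; rewrite gt_eqF.
move: (f (_ + a *: _)) (f (_ + b *: _)) (f (_ + c *: _)) (dot v v) => pa pb pc V h1 h2.
apply/andP; split.
  have := ler_wpM2l (ltW ac) h1.
  rewrite -subr_ge0 => h; rewrite -subr_ge0; move: h; congr (0 <= _).
  by rewrite /t; field; rewrite gt_eqF.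
have := ler_wpM2l (ltW ac) h2.
rewrite -subr_ge0 => h; rewrite -subr_ge0; move: h; congr (0 <= _).
by rewrite /t; field; rewrite gt_eqF.
Qed.

Definition slope x v t : R := t^-1 * (f (x + t *: v) - f x).

(** Each sign pattern of [s] and [t] is one ordering of the three nodes [0], [s]
    and [t] of a divided difference. *)
Lemma slope_bounds x v s t : s != 0 -> t != 0 -> s < t ->
  mu / 2 * dot v v * (t - s) <= slope x v t - slope x v s <=
  L / 2 * dot v v * (t - s).
Proof.
move=> s0 t0 st.
have phiE r : r != 0 -> f (x + r *: v) = f x + r * slope x v r.
  by move=> r0; rewrite /slope mulrA mulfV// mul1r subrKC.
have phi0 : f (x + 0 *: v) = f x by rewrite scale0r addr0.
have [sp|sn|s_eq] := ltgtP 0 s; last by rewrite -s_eq eqxx in s0.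
- have st0 : 0 < s * t by nra.
  have /= := divided_difference_bounds x v sp st; rewrite phi0 (phiE _ s0) (phiE _ t0).
  move: (f x) (slope x v s) (slope x v t) (dot v v) => fx qs qt V /andP[h1 h2].
  by apply/andP; split; rewrite -(ler_pM2l st0); lra.
have [tp|tn|t_eq] := ltgtP 0 t; last by rewrite -t_eq eqxx in t0.
- have st0 : 0 < - s * t by nra.
  have /= := divided_difference_bounds x v sn tp; rewrite phi0 (phiE _ s0) (phiE _ t0).
  move: (f x) (slope x v s) (slope x v t) (dot v v) => fx qs qt V /andP[h1 h2].
  by apply/andP; split; rewrite -(ler_pM2l st0); lra.
- have st0 : 0 < s * t by nra.
  have /= := divided_difference_bounds x v st tn; rewrite phi0 (phiE _ s0) (phiE _ t0).
  move: (f x) (slope x v s) (slope x v t) (dot v v) => fx qs qt V /andP[h1 h2].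
  by apply/andP; split; rewrite -(ler_pM2l st0); lra.
Qed.

(** The slope is nondecreasing, so its limit at [0] from the left is a
    supremum. *)
Definition dirderiv x v : R := sup [set slope x v t | t in [set t | t < 0]].

(** The slope is Lipschitz across [0], so its left limit is a two-sided one. *)
Lemma slope_dirderiv x v t : t != 0 ->
  `|slope x v t - dirderiv x v| <= L * dot v v * `|t|.
Proof.
move=> t0.
have V0 := dotvv_ge0 v.
have mV : 0 <= mu / 2 * dot v v by rewrite mulr_ge0// divr_ge0.
have L0 : 0 <= L := le_trans mu0 muL.
have LV : 0 <= L / 2 * dot v v by rewrite mulr_ge0// divr_ge0.
have mono r s : r != 0 -> s != 0 -> r <= s -> slope x v r <= slope x v s.
  move=> r0 s0; rewrite le_eqVlt => /predU1P[->//|rs].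
  have /andP[h _] := slope_bounds x v r0 s0 rs.
  by rewrite -subr_ge0 (le_trans _ h)// mulr_ge0// subr_ge0 ltW.
have lip r s : r != 0 -> s != 0 -> r <= s ->
    slope x v s <= slope x v r + L / 2 * dot v v * (s - r).
  move=> r0 s0; rewrite le_eqVlt => /predU1P[->|rs]; first by rewrite subrr mulr0 addr0.
  by have /andP[_ h] := slope_bounds x v r0 s0 rs; rewrite -lerBlDl.
have nz (r : R) : r < 0 -> r != 0 by move=> /lt_eqF ->.
have ubd s : 0 < s -> ubound [set slope x v t | t in [set t | t < 0]] (slope x v s).
  move=> s0 _ [r /= r0 <-]; apply: mono; [exact: nz|by rewrite gt_eqF|lra].
have hs : has_sup [set slope x v t | t in [set t | t < 0]].
  by split; [exists (slope x v (-1)), (-1) => //=; rewrite ltrN10|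
    exists (slope x v 1); exact: ubd].
have neg r : r < 0 -> slope x v r <= dirderiv x v <= slope x v r - L / 2 * dot v v * r.
  move=> r0; apply/andP; split; first by apply: sup_upper_bound => //; exists r.
  apply: sup_le_ub; first by case: hs.
  move=> _ [s /= s0 <-]; have [rs|/ltW sr] := leP r s.
    apply: (le_trans (lip r s _ _ rs)); rewrite ?nz//.
    by rewrite lerD2l; rewrite -mulrN ler_wpM2l//; lra.
  apply: (le_trans (mono _ _ _ _ sr)); rewrite ?nz//.
  by rewrite lerDl -mulrN mulr_ge0//; lra.
have [tp|tn|t_eq] := ltgtP 0 t; last by rewrite -t_eq eqxx in t0.
- have /andP[h1 h2] := neg (- t) ltac:(lra).
  have h3 := lip (- t) t ltac:(by rewrite oppr_eq0) t0 ltac:(lra).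
  have h4 : dirderiv x v <= slope x v t.
    by apply: sup_le_ub; [case: hs|exact: ubd].
  by rewrite ger0_norm ?subr_ge0// gtr0_norm//; lra.
- have /andP[h1 h2] := neg t tn.
  rewrite ler0_norm ?subr_le0// ltr0_norm//.
  by have := mulr_ge0 LV (ltW (_ : 0 < - t)); lra.
Qed.

Lemma derive_dirderiv x v : 'D_v (f : 'rV[R]_d -> R^o) x = dirderiv x v.
Proof.
rewrite /derive; apply: cvg_lim => //.
apply/cvgrPdist_le => e e0; rewrite /=.
have K0 : 0 < L * dot v v + 1.
  by rewrite ltr_wpDl// mulr_ge0// ?dotvv_ge0// (le_trans mu0).
near=> h.
have h0 : h != 0 by near: h; exact: nbhs_dnbhs_neq.
rewrite distrC.
have := slope_dirderiv x v h0; rewrite /slope (addrC x); move/le_trans; apply.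
apply: (@le_trans _ _ ((L * dot v v + 1) * `|h|)).
  by rewrite ler_wpM2r// lerDl.
rewrite mulrC -ler_pdivlMr//; near: h.
apply: dnbhs0_le; exact: divr_gt0.
Unshelve. all: by end_near. Qed.
End Smooth.

(** * Gradient inequalities and interpolation *)

Section Gradient.
Context {R : realType} {d : nat}.
Variables (mu L : R) (f : 'rV[R]_d -> R).
Hypotheses (mu0 : 0 <= mu) (muL : mu <= L) (fF : Fclass mu L f).
Implicit Types (x v w : 'rV[R]_d) (s t : R).

Let L0 : 0 <= L := le_trans mu0 muL.

Lemma le_of_linear_error (a b K : R) : 0 <= K ->
  (forall t, 0 < t < 1 -> a <= b + K * t) -> a <= b.
Proof.
move=> K0 h; apply/ler_addgt0Pr => e e0.
have K1 : 0 < K + 1 by rewrite ltr_wpDl.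
pose t := Num.min (1 / 2) (e / (K + 1)).
have t0 : 0 < t by rewrite lt_min divr_gt0//= divr_gt0.
have t1 : t < 1 by rewrite gt_min; apply/orP; left; lra.
apply: (le_trans (h t _)); first by rewrite t0.
rewrite lerD2l; apply: (@le_trans _ _ ((K + 1) * t)).
  by rewrite ler_wpM2r ?lerDl// ltW.
by rewrite mulrC -ler_pdivlMr// ge_min lexx orbT.
Qed.

Lemma dirderiv_bounds x v :
  dirderiv f x v + mu / 2 * dot v v <= f (x + v) - f x <=
  dirderiv f x v + L / 2 * dot v v.
Proof.
have V0 := dotvv_ge0 v.
have mV : 0 <= mu / 2 * dot v v by rewrite mulr_ge0// divr_ge0.
have LV : 0 <= L / 2 * dot v v by rewrite mulr_ge0// divr_ge0.
have -> : f (x + v) - f x = slope f x v 1 by rewrite /slope invr1 mul1r scale1r.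
have H t : 0 < t < 1 -> [/\ mu / 2 * dot v v * (1 - t) <= slope f x v 1 - slope f x v t,
    slope f x v 1 - slope f x v t <= L / 2 * dot v v * (1 - t),
    slope f x v t - dirderiv f x v <= L * dot v v * t &
    - (L * dot v v * t) <= slope f x v t - dirderiv f x v].
  move=> /andP[t0 t1]; have tn0 : t != 0 by rewrite gt_eqF.
  have /andP[h1 h2] := slope_bounds fF x v tn0 (oner_neq0 R) t1.
  have := slope_dirderiv mu0 muL fF x v tn0; rewrite (gtr0_norm t0) ler_norml => /andP[h3 h4].
  by split.
apply/andP; split.
- apply: (@le_of_linear_error _ _ (L * dot v v + mu / 2 * dot v v)) => [|t /H[*]]; last by lra.
  by rewrite addr_ge0// mulr_ge0.
- apply: (@le_of_linear_error _ _ (L * dot v v)) => [|t t01]; first by rewrite mulr_ge0.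
  have [h1 h2 h3 h4] := H t t01; have := andP t01 => -[t0 _].
  by have := mulr_ge0 LV (ltW t0); lra.
Qed.

Lemma dirderivZ x v (a : R) : dirderiv f x (a *: v) = a * dirderiv f x v.
Proof.
have V0 := dotvv_ge0 v.
have [->|a0] := eqVneq a 0.
  have := slope_dirderiv mu0 muL fF x (0 *: v) (oner_neq0 R).
  rewrite /slope scale0r scaler0 addr0 subrr mulr0 sub0r normrN.
  rewrite /dot big1 ?mulr0 ?mul0r; last by move=> i _; rewrite mxE mul0r.
  by rewrite normr_le0 => /eqP.
apply/eqP; rewrite -subr_eq0 -normr_le0.
apply: (@le_of_linear_error _ _ (2 * (L * dot (a *: v) (a *: v)))) => [|t /andP[t0 t1]].
  by rewrite !mulr_ge0// dotvv_ge0.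
have tn0 : t != 0 by rewrite gt_eqF.
have h1 := slope_dirderiv mu0 muL fF x (a *: v) tn0.
have atn0 : a * t != 0 by rewrite mulf_neq0.
have := slope_dirderiv mu0 muL fF x v atn0; rewrite -(ler_pM2l (_ : 0 < `|a|)) ?normr_gt0//.
rewrite -normrM mulrBr.
have -> : a * slope f x v (a * t) = slope f x (a *: v) t.
  by rewrite /slope scalerA (mulrC t a); field; rewrite a0 tn0.
rewrite normrM (gtr0_norm t0) in h1 *.
have -> : `|a| * (L * dot v v * (`|a| * t)) = L * dot (a *: v) (a *: v) * t.
  have aa : a * a = `|a| * `|a| by rewrite -normrM ger0_norm// -expr2 sqr_ge0.
  rewrite dotZl dotZr. rewrite (mulrA a a). rewrite aa. ring.
move=> h2; rewrite add0r.
have -> : dirderiv f x (a *: v) - a * dirderiv f x v =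
  (slope f x (a *: v) t - a * dirderiv f x v)
   - (slope f x (a *: v) t - dirderiv f x (a *: v)) by ring.
by apply: (le_trans (ler_normB _ _)); lra.
Qed.

(** Convexity at the midpoint of [x + 2 t v] and [x + 2 t w] gives this up to an
    error of order [t]. *)
Lemma dirderiv_subadd x v w : dirderiv f x (v + w) <= dirderiv f x v + dirderiv f x w.
Proof.
apply: (@le_of_linear_error _ _ (L * (dot v v + dot w w))) => [|t /andP[t0 t1]].
  by rewrite mulr_ge0// addr_ge0// dotvv_ge0.
have h01 : 0 <= (1 / 2 : R) <= 1 by apply/andP; split; lra.
have [h _] := Fclass_conv fF (x + (2 * t) *: v) (x + (2 * t) *: w) h01.
have {h} : f (x + t *: (v + w)) <= 1 / 2 * f (x + (2 * t) *: v)
    + 1 / 2 * f (x + (2 * t) *: w).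
  have -> : x + t *: (v + w) = (1 / 2) *: (x + (2 * t) *: v)
      + (1 - 1 / 2) *: (x + (2 * t) *: w).
    rewrite (_ : 1 - 1 / 2 = 1 / 2 :> R); last by field.
    rewrite -scalerDr addrACA -(scalerDr (2 * t)) [RHS]scalerDr scalerA.
    rewrite (_ : x + x = 2 *: x) ?scalerA; last by rewrite scaler_nat mulr2n.
    by rewrite (mulrA _ 2 t) divfK ?pnatr_eq0// mul1r scale1r.
  apply: (le_trans h); rewrite (_ : 1 - 1 / 2 = 1 / 2 :> R); last by field.
  by rewrite gerBl mulr_ge0 ?divr_ge0// mulr_ge0 ?dotvv_ge0// mulr_ge0.
have /andP[hv _] := dirderiv_bounds x (t *: (v + w)).
have /andP[_ h1] := dirderiv_bounds x ((2 * t) *: v).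
have /andP[_ h2] := dirderiv_bounds x ((2 * t) *: w).
have : 0 <= mu / 2 * dot (t *: (v + w)) (t *: (v + w)).
  by rewrite mulr_ge0 ?divr_ge0 ?dotvv_ge0.
move: hv h1 h2; rewrite !dirderivZ ![dot (_ *: _) _]dotZl ![dot _ (_ *: _)]dotZr.
move: (dot (v + w) _) (dot v v) (dot w w) => Q V W hv h1 h2 hq hc.
rewrite -(ler_pM2l t0); lra.
Qed.

(** A homogeneous subadditive map is additive: apply subadditivity to the
    opposite vectors. *)
Lemma dirderivD x v w : dirderiv f x (v + w) = dirderiv f x v + dirderiv f x w.
Proof.
apply/eqP; rewrite eq_le dirderiv_subadd/=.
have dirderivN u : dirderiv f x (- u) = - dirderiv f x u by rewrite -scaleN1r dirderivZ mulN1r.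
by have := dirderiv_subadd x (- v) (- w); rewrite -opprD !dirderivN; lra.
Qed.

Lemma dirderiv_grad x v : dirderiv f x v = dot (grad f x) v.
Proof.
rewrite {1}(row_sum_delta v).
have -> : forall s : seq 'I_d, dirderiv f x (\sum_(i <- s) v 0 i *: delta_mx 0 i) =
    \sum_(i <- s) v 0 i * dirderiv f x (delta_mx 0 i).
  elim=> [|i s IH]; last by rewrite !big_cons dirderivD IH dirderivZ.
  by rewrite !big_nil -(scale0r 0) dirderivZ mul0r.
by apply: eq_bigr => i _; rewrite mxE (derive_dirderiv mu0 muL fF) mulrC.
Qed.

Lemma Fclass_bounds x v :
  dot (grad f x) v + mu / 2 * dot v v <= f (x + v) - f x <=
  dot (grad f x) v + L / 2 * dot v v.
Proof. by rewrite -dirderiv_grad dirderiv_bounds. Qed.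
End Gradient.

(** The lower bound that the class puts on [2 * (L - mu) * (f x - f y)], in terms
    of [gy = grad f y], [e = grad f x - grad f y] and [u = x - y]. *)
Definition interp_form (R : realType) d (mu L : R) (gy e u : 'rV[R]_d) : R :=
  2 * (L - mu) * dot gy u + dot e e + mu * L * dot u u - 2 * mu * dot e u.

Section Interpolation.
Context {R : realType} {d : nat}.
Variables (mu L : R) (f : 'rV[R]_d -> R) (g : 'rV[R]_d -> 'rV[R]_d).
Hypothesis (muL : mu < L).
Hypothesis fg : forall x v,
  dot (g x) v + mu / 2 * dot v v <= f (x + v) - f x <=
  dot (g x) v + L / 2 * dot v v.

(** Compare the upper bound at [x] with the lower bound at [y] in a common third
    point [x + w]; the shift [w] is the one that makes the comparison best. *)
Lemma interpolation x y :
  interp_form mu L (g y) (g x - g y) (x - y) <= 2 * (L - mu) * (f x - f y).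
Proof.
rewrite /interp_form.
have M0 : 0 < L - mu by rewrite subr_gt0.
pose u := x - y; pose e := g x - g y.
pose w := - (L - mu)^-1 *: (e - mu *: u).
have /andP[_ h1] := fg x w.
have /andP[h2 _] := fg y (u + w).
have xE : y + (u + w) = x + w by rewrite addrA subrKC.
rewrite xE in h2.
have gx : g x = g y + e by rewrite subrKC.
rewrite -/u -/e gx in h1 *.
have h : dot (g y) (u + w) + mu / 2 * dot (u + w) (u + w)
   - dot (g y + e) w - L / 2 * dot w w <= f x - f y by lra.
have M20 : 0 < 2 * (L - mu) by rewrite mulr_gt0.
rewrite -(ler_pM2l M20) in h; apply: le_trans h.
clearbody u e; rewrite /w !dotE (dotC u e) le_eqVlt; apply/orP; left; apply/eqP.
by field; rewrite gt_eqF.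
Qed.
End Interpolation.

(** * The stepsize *)

Section Root.
Context {R : realType}.
Variables (N : nat) (kappa : R).
Hypotheses (N0 : (0 < N)%N) (kappa_gt0 : 0 < kappa) (kappa_lt1 : kappa < 1).
Implicit Types (l : R).

Lemma itv_params l : 1 < l < 2 / (1 + kappa) ->
  [/\ 1 - l < 0, - (1 - l) < 1 - kappa * l & 1 - kappa * l < 1].
Proof.
have k0 := kappa_gt0; have k1 := kappa_lt1.
move=> /andP[l1]; rewrite ltr_pdivlMr; last by rewrite addr_gt0.
by move=> h; split; nra.
Qed.

Lemma Tfun_eq0 l : 1 < l < 2 / (1 + kappa) ->
  (Tfun N l kappa = 0) <->
  (1 - kappa * l) ^- (2 * N) - 1 = kappa * ((1 - l) ^- (2 * N) - 1).
Proof.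
have k0 := kappa_gt0.
move=> hl; have [h1 h2 h3] := itv_params hl.
have l0 : 0 < l by lra.
have e0 : 1 - kappa * l != 0 by rewrite gt_eqF//; lra.
have r0 : 1 - l != 0 by rewrite lt_eqF.
rewrite -(Esum_geom N e0) -(Esum_geom N r0) /Tfun !subKr mulrA; split.
  by move/eqP; rewrite subr_eq0 => /eqP ->.
move/mulfI; rewrite mulf_neq0 ?gt_eqF// => /(_ isT) ->.
by rewrite subrr.
Qed.

Lemma inv_pow_mono (x y : R) : 0 < x -> x < y -> y ^- (2 * N) < x ^- (2 * N).
Proof.
move=> x0 xy; have y0 := lt_trans x0 xy.
have N2 : (2 * N)%N != 0%N by rewrite -lt0n muln_gt0.
rewrite ltf_pV2 ?posrE ?exprn_gt0//.
by rewrite ltrXn2r// ltW.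
Qed.

(** As [l] grows, the left-hand side of the equation in [Tfun_eq0] increases
    and the right-hand side decreases. *)
Lemma Tfun_root_le l l' : 1 < l < 2 / (1 + kappa) -> 1 < l' < 2 / (1 + kappa) ->
  Tfun N l kappa = 0 -> Tfun N l' kappa = 0 -> l' <= l.
Proof.
have k0 := kappa_gt0.
move=> hl hl' /(Tfun_eq0 hl) tl /(Tfun_eq0 hl') tl'; rewrite leNgt; apply/negP => ll'.
have [h1 h2 h3] := itv_params hl; have [h1' h2' h3'] := itv_params hl'.
have eta_lt : 1 - kappa * l' < 1 - kappa * l by rewrite ltrD2l ltrN2 ltr_pM2l.
have := @inv_pow_mono (1 - kappa * l') (1 - kappa * l) ltac:(lra) eta_lt.
have := @inv_pow_mono (- (1 - l)) (- (1 - l')) ltac:(lra) ltac:(lra).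
by rewrite !exprM !sqrrN -!exprM -(ltr_pM2l k0); lra.
Qed.

(** Clearing the denominators leaves a polynomial, which changes sign: it is
    negative at [1], where [1 - l] vanishes, and positive at the right end, where
    [1 - kappa l] and [l - 1] coincide. *)
Lemma Tfun_root_exists : exists2 l, 1 < l < 2 / (1 + kappa) & Tfun N l kappa = 0.
Proof.
have k0 := kappa_gt0; have k1 := kappa_lt1.
pose A : {poly R} := (1 - kappa *: 'X) ^+ (2 * N).
pose B : {poly R} := (1 - 'X) ^+ (2 * N).
pose p := B * (1 - A) - kappa *: (A * (1 - B)).
have AE x : A.[x] = (1 - kappa * x) ^+ (2 * N) by rewrite /A !hornerE.
have BE x : B.[x] = (1 - x) ^+ (2 * N) by rewrite /B !hornerE.
have pE x : p.[x] = B.[x] * (1 - A.[x]) - kappa * (A.[x] * (1 - B.[x])).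
  by rewrite /p !hornerE.
have NN0 : (0 < 2 * N)%N by rewrite muln_gt0.
have k10 : 0 < 1 + kappa by lra.
have p1 : p.[1] < 0.
  rewrite pE AE BE subrr mulr1 expr0n eqn0Ngt NN0 mul0r subr0 mulr1 sub0r oppr_lt0.
  by rewrite mulr_gt0// exprn_gt0//; lra.
set c := 2 / (1 + kappa).
have cE : c * (1 + kappa) = 2 by rewrite /c divfK// gt_eqF.
have c1 : 1 < c by rewrite ltr_pdivlMr; lra.
have pc : 0 < p.[c].
  have AB : A.[c] = B.[c].
    rewrite AE BE [RHS]exprM -sqrrN -[RHS]exprM; congr (_ ^+ _); lra.
  have c2 : c < 2 by rewrite ltr_pdivrMr//; lra.
  have B0 : 0 < B.[c] by rewrite BE exprM exprn_gt0// exprn_even_gt0//= lt_eqF; lra.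
  have B1 : B.[c] < 1.
    rewrite BE exprM exprn_ilt1 ?sqr_ge0//.
      by rewrite -lt0n.
    by nra.
  rewrite pE AB (_ : _ - _ = (1 - kappa) * (B.[c] * (1 - B.[c]))); last by ring.
  by rewrite !mulr_gt0// subr_gt0.
have [|l /andP[l1 lc] /rootP pl] := @poly_ivt _ p 1 c (ltW c1).
  by rewrite !ltW.
have hl : 1 < l < c.
  rewrite lt_neqAle l1 [l < c]lt_neqAle lc !andbT; apply/andP; split; apply/eqP => h.
    by rewrite -h in pl; rewrite pl ltxx in p1.
  by rewrite h in pl; rewrite pl ltxx in pc.
exists l => //; apply/(Tfun_eq0 hl).
have [h1 h2 h3] := itv_params hl.
move: pl; rewrite pE AE BE => pl.
have e0 : (1 - kappa * l) ^+ (2 * N) != 0 by rewrite expf_neq0// gt_eqF//; lra.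
have r0 : (1 - l) ^+ (2 * N) != 0 by rewrite expf_neq0// lt_eqF.
apply: (mulfI (mulf_neq0 e0 r0)); apply/eqP; rewrite -subr_eq0 -{}pl; apply/eqP.
by field; apply/andP.
Qed.

Lemma gammaLbarP : 1 < gammaLbar N kappa < 2 / (1 + kappa) /\
  Tfun N (gammaLbar N kappa) kappa = 0.
Proof.
have [l hl tl] := Tfun_root_exists.
rewrite /gammaLbar; set P := (X in get X).
have Pl : P l.
  by split=> // l' [hl' tl']; apply: le_anti; rewrite !Tfun_root_le.
by have [] := getI Pl.
Qed.
End Root.

(** * The worst-case rate as a function of the stepsize *)

Section RateOpt.
Context {R : realType}.
Implicit Types (N : nat) (x : R).

Lemma inv_pow2_ne0 N x : x != 0 -> inv_pow2 N x = (x ^- (2 * N))%:E.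
Proof. by move=> x0; rewrite /inv_pow2 inver expf_eq0 (negbTE x0) andbF. Qed.

Lemma inv_pow2_ge1 N x : `|x| <= 1 -> (1 <= inv_pow2 N x)%E.
Proof.
move=> x1; rewrite /inv_pow2 inver; case: ifPn => [_|xn0]; first by rewrite leey.
have x0 : 0 < x ^+ (2 * N) by rewrite lt_neqAle eq_sym xn0 exprM exprn_ge0// sqr_ge0.
rewrite lee_fin invf_ge1// -(gtr0_norm x0) normrX exprn_ile1//.
Qed.

Definition sc_denom (mu L : R) N (gamma : R) : \bar R :=
  (1 + (gamma * L)%:E *
        Order.min ((- 1 + inv_pow2 N (1 - gamma * mu)) / (gamma * mu)%:E)
                  ((- 1 + inv_pow2 N (1 - gamma * L)) / (gamma * L)%:E))%E.

Lemma sc_denom_ge1 (mu L : R) N gamma : 0 < mu -> mu < L -> 0 < gamma * L < 2 ->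
  (1 <= sc_denom mu L N gamma)%E.
Proof.
move=> mu0 muL /andP[gL0 gL2].
have L0 := lt_trans mu0 muL.
have g0 : 0 < gamma by rewrite -(pmulr_lgt0 _ L0).
have gmu0 : 0 < gamma * mu by rewrite mulr_gt0.
have gmuL : gamma * mu < gamma * L by rewrite ltr_pM2l.
have term x : 0 < x -> x < 2 -> (0 <= (- 1 + inv_pow2 N (1 - x)) / x%:E)%E.
  move=> x0 x2; rewrite mule_ge0//; last by rewrite inve_ge0 lee_fin ltW.
  have x1 : `|1 - x| <= 1 by rewrite ler_norml; apply/andP; split; lra.
  apply: le_trans (leeD2l (- 1)%E (inv_pow2_ge1 N x1)).
  by rewrite -EFinN -EFinD addNr.
rewrite /sc_denom -[X in (X <= _)%E]adde0 leeD2l// mule_ge0//.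
  by rewrite lee_fin ltW.
by rewrite le_min !term//; lra.
Qed.

Lemma sc_denom_term (L gamma x : R) N : 0 < gamma * L -> 0 < x -> x != 1 ->
  (1 + (gamma * L)%:E * ((- 1 + inv_pow2 N (1 - x)) / x%:E) =
  (1 + gamma * L / x * ((1 - x) ^- (2 * N) - 1))%:E)%E.
Proof.
move=> gL0 x0 x1; rewrite inv_pow2_ne0 ?subr_eq0 1?eq_sym// inver gt_eqF//.
rewrite -EFinN -!(EFinD, EFinM); congr (_ %:E).
have xn0 : x != 0 by rewrite gt_eqF.
have pn0 : (1 - x) ^+ (2 * N) != 0 by rewrite expf_neq0// subr_eq0 eq_sym.
by field; rewrite ?xn0 ?pn0.
Qed.

(** To the left of the chosen stepsize the denominator is bounded by the term in
    [mu], which increases with the stepsize; to the right, by the term in [L],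
    which decreases.  At the chosen stepsize both equal [r]. *)
Lemma sc_rate_min (mu L : R) N gb delta gamma : (0 < N)%N -> 0 < mu -> mu < L ->
  gb * L = gammaLbar N (mu / L) -> 0 <= delta -> 0 < gamma * L < 2 ->
  (sc_rate mu L N delta gb <= sc_rate mu L N delta gamma)%E.
Proof.
move=> N0 mu0 muL gbE delta0 hg.
have L0 := lt_trans mu0 muL; have Ln0 : L != 0 by rewrite gt_eqF.
have k0 : 0 < mu / L by rewrite divr_gt0.
have k1 : mu / L < 1 by rewrite ltr_pdivrMr// mul1r.
have [hl tl] := gammaLbarP N0 k0 k1; rewrite -gbE in hl tl.
have muE g : g * mu = mu / L * (g * L) by field.
have [h1 h2 h3] := itv_params k0 k1 hl; rewrite -muE in h2 h3.
have /andP[gL0 gL2] := hg.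
have lb1 : 1 < gb * L by case/andP: hl.
have mun0 : mu != 0 by rewrite gt_eqF.
pose r := (1 - gb * L) ^- (2 * N).
have rE : 1 + L / mu * ((1 - gb * mu) ^- (2 * N) - 1) = r.
  rewrite muE ((Tfun_eq0 N k0 k1 hl).1 tl) -/r.
  by field; apply/andP.
have term_mu g : 0 < g * L -> 1 - g * mu > 0 ->
    (1 + (g * L)%:E * ((- 1 + inv_pow2 N (1 - g * mu)) / (g * mu)%:E) =
    (1 + L / mu * ((1 - g * mu) ^- (2 * N) - 1))%:E)%E.
  move=> gL e0; rewrite sc_denom_term//; first last.
  - by rewrite -subr_eq0 -oppr_eq0 opprB gt_eqF.
  - by rewrite muE mulr_gt0.
  congr (_ + _ * _)%:E; have g0 : g != 0 by apply: contraTneq gL => ->; rewrite mul0r ltxx.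
  by field; apply/andP.
have term_L g : 1 < g * L ->
    (1 + (g * L)%:E * ((- 1 + inv_pow2 N (1 - g * L)) / (g * L)%:E) =
    ((1 - g * L) ^- (2 * N))%:E)%E.
  move=> gL; rewrite sc_denom_term ?(lt_trans ltr01 gL)// ?gt_eqF//.
  by rewrite divff ?mul1r ?subrKC// gt_eqF// (lt_trans ltr01 gL).
have denb : sc_denom mu L N gb = r%:E.
  have gb0 := lt_trans ltr01 lb1.
  rewrite /sc_denom; case: leP => _; last by rewrite term_L.
  by rewrite term_mu ?rE//; lra.
have den : (sc_denom mu L N gamma <= r%:E)%E.
  have [le|lt] := leP (gamma * L) (gb * L).
    have le_mu : gamma * mu <= gb * mu by rewrite !muE ler_pM2l.
    apply: (@le_trans _ _ (1 + L / mu * ((1 - gamma * mu) ^- (2 * N) - 1))%:E).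
      rewrite -term_mu//; last lra.
      by rewrite leeD2l// lee_pmul2l ?lte_fin// ge_min lexx.
    rewrite -rE lee_fin lerD2l ler_pM2l ?divr_gt0// lerD2r.
    rewrite lef_pV2 ?posrE ?exprn_gt0//; try lra.
    by apply: lerXn2r; rewrite ?nnegrE; lra.
  have lg := lt_trans lb1 lt.
  apply: (@le_trans _ _ ((1 - gamma * L) ^- (2 * N))%:E).
    rewrite -term_L//.
    by rewrite leeD2l// lee_pmul2l ?lte_fin// ge_min lexx orbT.
  rewrite lee_fin /r !exprM -(sqrrN (1 - gamma * L)) -(sqrrN (1 - gb * L)) -!exprM.
  by apply/ltW/inv_pow_mono => //; lra.
have dge1 := sc_denom_ge1 N mu0 muL hg.
have denfin : sc_denom mu L N gamma \is a fin_num.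
  by rewrite fin_numE -ltNye -ltey (le_lt_trans den) ?ltry// (lt_le_trans _ dge1)// ltNyr.
rewrite /sc_rate -/(sc_denom mu L N gb) -/(sc_denom mu L N gamma) denb.
move: den dge1; rewrite -(fineK denfin); set e := fine _.
rewrite !lee_fin => er e1.
have e0 : 0 < e by apply: lt_le_trans e1.
have r0 : 0 < r := lt_le_trans e0 er.
by rewrite !inver !gt_eqF// -!EFinM lee_fin ler_wpM2l// lef_pV2.
Qed.

End RateOpt.

(** * Gradient descent *)

Section GradientDescent.
Context {R : realType} {d : nat}.
Implicit Types (f : 'rV[R]_d -> R) (x : nat -> 'rV[R]_d).

Section Steps.
Variables (mu L gamma D : R).
Hypotheses (gamma_gt0 : 0 < gamma) (mu_lt_L : mu < L).
Local Notation eta := (1 - gamma * mu).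
Local Notation rho := (1 - gamma * L).

Lemma forward_step (a b : 'rV[R]_d) :
  interp_form mu L b (a - b) (gamma *: a) <= 2 * (L - mu) * D ->
  dot b b - 2 * rho * dot a b + rho ^+ 2 * dot a a
    + (eta - rho) * (1 + rho) * dot a a <= (eta - rho) * (2 / gamma * D).
Proof.
have gn0 : gamma != 0 by rewrite gt_eqF.
rewrite [X in _ -> _ <= X](_ : _ = 2 * (L - mu) * D); last by field.
apply: le_trans; rewrite /interp_form !dotE (dotC b a).
by rewrite le_eqVlt; apply/predU1P; left; ring.
Qed.

Lemma backward_step (a b : 'rV[R]_d) :
  interp_form mu L a (b - a) (- (gamma *: a)) <= 2 * (L - mu) * - D ->
  dot b b - 2 * eta * dot a b + eta ^+ 2 * dot a a
    - (eta - rho) * (1 + eta) * dot a a <= (eta - rho) * (2 / gamma * - D).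
Proof.
have gn0 : gamma != 0 by rewrite gt_eqF.
rewrite [X in _ -> _ <= X](_ : _ = 2 * (L - mu) * - D); last by field.
apply: le_trans; rewrite /interp_form !dotE (dotC b a).
by rewrite le_eqVlt; apply/predU1P; left; ring.
Qed.

(** The weights [eta] and [- rho] are those that cancel the inner product of
    [a] and [c]. *)
Lemma double_step (a b c : 'rV[R]_d) : 0 < eta -> rho < 0 ->
  interp_form mu L c (a - c) (gamma *: (a + b)) <= 2 * (L - mu) * D ->
  interp_form mu L a (c - a) (- (gamma *: (a + b))) <= 2 * (L - mu) * - D ->
  (eta + rho + eta * rho) * dot a a + (1 - eta - rho + eta * rho) * dot b b
    + dot c c + 2 * (eta * rho) * dot a b + 2 * dot b c
    <= (eta + rho) * (2 / gamma * D).
Proof.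
rewrite -oppr_gt0 => e0 r0.
rewrite -(ler_pM2l e0) => f2; rewrite -(ler_pM2l r0) => b2.
have gn0 : gamma != 0 by rewrite gt_eqF.
have M0 : 0 < L - mu by rewrite subr_gt0.
rewrite -(ler_pM2l (mulr_gt0 gamma_gt0 M0)).
rewrite [leRHS](_ : _ = eta * (2 * (L - mu) * D) + - rho * (2 * (L - mu) * - D));
  last by field.
apply: le_trans (lerD f2 b2).
rewrite /interp_form !dotE (dotC c a) (dotC b a) (dotC c b).
by rewrite le_eqVlt; apply/predU1P; left; ring.
Qed.

End Steps.

Lemma gd_decrease (mu L gamma : R) N f x : mu < L -> 0 < gamma ->
  (forall y v, dot (grad f y) v + mu / 2 * dot v v <= f (y + v) - f y <=
     dot (grad f y) v + L / 2 * dot v v) ->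
  1 - gamma * L < 0 -> - (1 - gamma * L) < 1 - gamma * mu -> 1 - gamma * mu < 1 ->
  (0 < N)%N -> Egap (1 - gamma * mu) (1 - gamma * L) N = 0 ->
  (forall i, (i < N)%N -> x i.+1 = x i - gamma *: grad f (x i)) ->
  gamma / 2 * Esum N (1 - gamma * L) * dot (grad f (x N)) (grad f (x N))
    <= f (x 0%N) - f (x N).
Proof.
move=> muL g0 fg r0 re e1 N0 EN gd.
have gn0 : gamma != 0 by rewrite gt_eqF.
pose g k := grad f (x k).
have := @chain_bound R (1 - gamma * mu) (1 - gamma * L) N (fun k => 2 / gamma * f (x k))
  (fun k => dot (g k) (g k)) (fun k => dot (g k) (g k.+1)) r0 re e1 N0 EN.
have step k : (k < N)%N -> x k - x k.+1 = gamma *: g k.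
  by move=> kN; rewrite gd// opprB subrKC.
have I := interpolation muL fg.
have e0 : 0 < 1 - gamma * mu by apply: lt_trans re; rewrite oppr_gt0.
move=> /= H; rewrite -(ler_pM2l (_ : 0 < 2 / gamma)) ?divr_gt0// mulrBr.
apply: le_trans (H _ _ _).
- by rewrite le_eqVlt; apply/predU1P; left; field.
- move=> k kN; rewrite -mulrBr; apply: forward_step => //.
  by rewrite -step//; exact: I.
- move=> k kN; rewrite -mulrBr -(opprB (f (x k))); apply: backward_step => //.
  by rewrite -step// !opprB; exact: I.
- move=> k kN; rewrite -mulrBr.
  have step2 : gamma *: (g k + g k.+1) = x k - x k.+2.
    by rewrite scalerDr -step ?(ltnW kN)// -step// addrA subrK.
  apply: double_step => //; rewrite step2 ?opprB; exact: I.
Qed.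

(** One step of length [1 / L] from [y] decreases [f] by at least the left-hand
    side; strong convexity makes [f] bounded below, so that the infimum is
    genuine. *)
Lemma gd_inf_le (mu L : R) f : 0 < mu -> mu < L ->
  (forall y v, dot (grad f y) v + mu / 2 * dot v v <= f (y + v) - f y <=
     dot (grad f y) v + L / 2 * dot v v) ->
  forall y, 1 / (2 * L) * dot (grad f y) (grad f y) <= f y - inf (range f).
Proof.
move=> mu0 muL fg y; have L0 := lt_trans mu0 muL.
have lb : has_lbound (range f).
  exists (f y - 1 / (2 * mu) * dot (grad f y) (grad f y)) => _ [z _ <-].
  have /andP[h _] := fg y (z - y); rewrite subrKC in h.
  have := dotvv_ge0 ((z - y) + mu^-1 *: grad f y).
  move: (z - y) h => v h; rewrite !dotE (dotC v) => h2.
  have {}h2 := mulr_ge0 (ltW (divr_gt0 mu0 (ltr0n R 2))) h2.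
  apply: le_trans (_ : _ <= dot (grad f y) v + mu / 2 * dot v v + f y) _; last by lra.
  rewrite -subr_ge0; apply: le_trans h2 _; rewrite le_eqVlt; apply/predU1P; left.
  by field; rewrite gt_eqF.
have /andP[_ h] := fg y (- L^-1 *: grad f y).
have : inf (range f) <= f (y + - L^-1 *: grad f y).
  by apply: ge_inf => //; exists (y + - L^-1 *: grad f y).
move=> hi; have {}hi : inf (range f) <= f y + (dot (grad f y) (- L^-1 *: grad f y) +
    L / 2 * dot (- L^-1 *: grad f y) (- L^-1 *: grad f y)) by lra.
rewrite lerBrDr -lerBrDl; apply: le_trans hi _; rewrite !dotE.
by rewrite le_eqVlt; apply/predU1P; left; field; rewrite gt_eqF.
Qed.
End GradientDescent.

(** * The optimal stepsize and its rate *)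

Unset Implicit Arguments.

Theorem proposition2p14 (R : realType) (L mu : R) (N : nat)
    (hL : 0 < L) (hmu : 0 < mu) (hmuL : mu < L) (hN : (1 <= N)%N)
    (gammabar : R) (hgammabar : gammabar * L = gammaLbar N (mu / L))
    (d : nat) (f : 'rV[R]_d -> R) (hf : Fclass mu L f) (x0 : 'rV[R]_d) :
  (0 < gammabar * L < 2 /\
   forall gamma : R, 0 < gamma * L < 2 ->
     (sc_rate mu L N (f x0 - inf (range f)) gammabar
      <= sc_rate mu L N (f x0 - inf (range f)) gamma)%E) /\
  (forall x : nat -> 'rV[R]_d,
     x 0%N = x0 ->
     (forall i : nat, (i < N)%N -> x i.+1 = x i - gammabar *: grad f (x i)) ->
     1 / (2 * L) * enorm (grad f (x N)) ^+ 2
     <= (f x0 - inf (range f)) / (1 - gammaLbar N (mu / L)) ^- (2 * N)).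
Proof.
have k0 : 0 < mu / L by rewrite divr_gt0.
have k1 : mu / L < 1 by rewrite ltr_pdivrMr// mul1r.
have fg := Fclass_bounds (ltW hmu) (ltW hmuL) hf.
have gap := gd_inf_le hmu hmuL fg.
have [hl tl] := gammaLbarP hN k0 k1; rewrite -hgammabar in hl tl *.
have [r0 re e1] := itv_params k0 k1 hl.
have muE : mu / L * (gammabar * L) = gammabar * mu by field; rewrite gt_eqF.
rewrite muE in re e1.
have l1 : 1 < gammabar * L by case/andP: hl.
have g0 : 0 < gammabar by rewrite -(pmulr_lgt0 _ hL); lra.
have gmu0 : 0 < gammabar * mu by rewrite mulr_gt0.
split; first split.
- by apply/andP; split; lra.
- move=> gamma hg; apply: sc_rate_min => //.
  by apply: le_trans (gap x0); rewrite mulr_ge0 ?dotvv_ge0// divr_ge0// mulr_ge0// ltW.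
move=> x x0E gd; rewrite enorm_sqr.
have EN : Egap (1 - gammabar * mu) (1 - gammabar * L) N = 0.
  by move: tl; rewrite /Tfun muE.
have dec := gd_decrease hmuL g0 fg r0 re e1 hN EN gd.
have last := gap (x N).
have rn0 : 1 - gammabar * L != 0 by rewrite lt_eqF.
have rp : 0 < (1 - gammabar * L) ^- (2 * N).
  by rewrite invr_gt0 exprM exprn_gt0// exprn_even_gt0//= lt_eqF.
rewrite ler_pdivlMr// -x0E.
have -> : (1 - gammabar * L) ^- (2 * N) = 1 + gammabar * L * Esum N (1 - gammabar * L).
  by have := Esum_geom N rn0; rewrite subKr; lra.
move: dec last; move: (dot _ _) (Esum _ _) (f _) (f _) (inf _) => n E f0 fN fi dec last.
suff : 1 / (2 * L) * n * (1 + gammabar * L * E) = gammabar / 2 * E * n + 1 / (2 * L) * n.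
  by move=> ->; lra.
by field; rewrite gt_eqF.
Qed.
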